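(* Let $f:\mathbb{R}^d\to\mathbb{R}$ be differentiable and bounded below, and suppose $\|\nabla f(w)-\nabla f(w')\|\le L\|w-w'\|$ for all $w,w'\in\mathbb{R}^d$. Let $\eta>0$ be arbitrary and let $(w_t)_{t\ge1}$ be generated by (coordinate-wise) AdaGrad (see context) with learning rate $\eta$, initial point $w_1\in\mathbb{R}^d$ and initial conditioner $\nu_0\in(0,\infty)^d$, where the stochastic gradients satisfy, for all $t\ge1$, $\mathbb{E}[g_t\mid\mathcal{F}_t]=\nabla f(w_t)$ and, for every coordinate $i\in\{1,\dots,d\}$, $$\mathbb{E}[|g_{t,i}|^2\mid\mathcal{F}_t]\le D_0+D_1\,(\partial_if(w_t))^2$$ for constants $D_0\ge0$, $D_1>0$. Then there is a constant $C$, independent of $T$ and $\delta$, such that for every integer $T\ge1$ and every $\delta\in(0,1)$, with probability at least $1-\delta$, $$\min_{1\le t\le T}\|\nabla f(w_t)\|^2\le C\,\frac{1+\ln(1+\sqrt{D_0T})}{T\delta^2}+C\,\frac{\sqrt{D_0}\,\bigl(1+\ln(1+\sqrt{D_0T})\bigr)}{\sqrt{T}\,\delta^2}.$$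
   Context: AdaGrad: given an objective $f:\mathbb{R}^d\to\mathbb{R}$, a learning rate $\eta>0$, a (deterministic) initial point $w_1\in\mathbb{R}^d$ and a (deterministic) initial conditioner $\nu_0\in(0,\infty)^d$, for $t=1,2,\dots$ one obtains a random vector (stochastic gradient) $g_t\in\mathbb{R}^d$ with coordinates $g_{t,l}$ and sets, for each coordinate $l$, $$\nu_{t,l}=\nu_{t-1,l}+g_{t,l}^2,\qquad w_{t+1,l}=w_{t,l}-\eta\,\frac{g_{t,l}}{\sqrt{\nu_{t,l}}}.$$ $\mathcal{F}_t:=\sigma(g_1,\dots,g_{t-1})$. $\|\cdot\|$ is the Euclidean norm and $\partial_i f$ the $i$-th partial derivative. *)

(* Defs.v *)
From HB Require Import structures.
From mathcomp Require Import all_boot all_order all_algebra.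
From mathcomp Require Import all_classical all_reals all_analysis.
Set Implicit Arguments.
Unset Strict Implicit.
Unset Printing Implicit Defensive.
Import Order.TTheory GRing.Theory Num.Theory.
Import numFieldNormedType.Exports.
Local Open Scope classical_set_scope.
Local Open Scope ring_scope.

(* The norm of the normed module 'rV[R]_d is the sup norm. *)
Definition enorm (R : realType) (d : nat) (v : 'rV[R]_d) : R :=
  Num.sqrt (\sum_(i < d) (v 0 i) ^+ 2).

Definition partial (R : realType) (d : nat) (f : 'rV[R]_d -> R) (i : 'I_d)
  (w : 'rV[R]_d) : R := 'D_(delta_mx 0 i) f w.

Definition grad (R : realType) (d : nat) (f : 'rV[R]_d -> R) (w : 'rV[R]_d) :
  'rV[R]_d := \row_(i < d) partial f i w.

(* F_t = sigma(g_1, ..., g_{t-1}); the Borel sigma-algebra of R^d is the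
   product one, so a vector and its coordinates generate the same events.
   F_1 is the trivial sigma-algebra. *)
Definition past (R : realType) (Omega : Type) (d : nat)
    (g : nat -> Omega -> 'rV[R]_d) (t : nat) : set_system Omega :=
  <<s [set A | exists s (i : 'I_d), (1 <= s < t)%N /\
       preimage_set_system [set: Omega] (fun x => g s x 0 i)
         (@measurable _ R) A] >>.

(* Y is a version of E[X | G], for a sub-sigma-algebra G and integrable X. *)
Definition is_cond_expectation (R : realType) (disp : measure_display)
    (Omega : measurableType disp) (P : probability Omega R)
    (G : set_system Omega) (X Y : Omega -> R) : Prop :=
  [/\ P.-integrable [set: Omega] (EFin \o X),
      P.-integrable [set: Omega] (EFin \o Y),
      preimage_set_system [set: Omega] Y (@measurable _ R) `<=` G &
      forall A, G A ->
        (\int[P]_(x in A) (X x)%:E = \int[P]_(x in A) (Y x)%:E)%E].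

(* Times are those of the usual presentation: nu starts at time 0, w and g at
   time 1; the values w 0 and g 0 are irrelevant. *)
Definition adagrad (R : realType) (Omega : Type) (d : nat) (eta : R)
    (w1 nu0 : 'rV[R]_d) (g nu w : nat -> Omega -> 'rV[R]_d) : Prop :=
  forall x : Omega,
    [/\ nu 0%N x = nu0,
        w 1%N x = w1 &
        forall (t : nat) (l : 'I_d), (1 <= t)%N ->
          nu t x 0 l = nu t.-1 x 0 l + (g t x 0 l) ^+ 2 /\
          w t.+1 x 0 l =
            w t x 0 l - eta * (g t x 0 l / Num.sqrt (nu t x 0 l))].

(* The minimum of a t over 1 <= t <= n, for 1 <= n. *)
Definition min_upto (R : realType) (a : nat -> R) (n : nat) : R :=
  \big[Num.min/a 1%N]_(1 <= t < n.+1) a t.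

(* Main.v *)
Require Import Defs.
From HB Require Import structures.
From mathcomp Require Import all_boot all_order all_algebra.
From mathcomp Require Import ring lra.
From mathcomp Require Import all_classical all_reals all_analysis measurable_realfun.
Set Implicit Arguments.
Unset Strict Implicit.
Unset Printing Implicit Defensive.
Import Order.TTheory GRing.Theory Num.Theory.
Import numFieldNormedType.Exports.
Local Open Scope classical_set_scope.
Local Open Scope ring_scope.

(** Write G for a coordinate of grad f(w_t), g for that of g_t, a = sqrt nu_{t-1},
b = sqrt nu_t and Q = D0 + D1 G^2. Replacing b by a in the descent inequality
costs |G g| (1/a - 1/b), which Young's inequality with the weight Q, known at
time t, bounds by (G^2 / (Q a)) g^2 / 2 + Q (1/a - 1/b) / 2. The first term has
conditional mean at most G^2 / (2 a). The second one telescopes, up to the drift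
(G_t^2 - G_{t-1}^2) / a, which smoothness bounds by a fraction of G_t^2 / a plus
multiples of g^2 / nu; the latter sum to a logarithm of nu. Hence, with
Y = sum_t sum_i G^2 / a and X = sum_i sqrt nu_{T,i}, E Y is bounded by
ln lam + E X / lam for every lam >= 1, up to constants. Conversely, the affine
variance bound integrated against 1 / sqrt (nu_{t-1} + D0 T) gives
E X <= C (1 + sqrt (D0 T)) + D1 E Y. Together these give E X = O(s) and
E Y = O(1 + ln s) for s = 1 + sqrt (D0 T). As the sum of the squared gradient norms is
at most X Y, Markov's inequality for X / (bound on E X) + Y / (bound on E Y)
concludes. *)

(** * Scalar inequalities for one coordinate *)

(* The hypothesis on [Q = 0] covers [D0 = 0] at a critical point, where
   [G ^+ 2 / Q] is [0 / 0 = 0]. *)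
Lemma adaptive_step_error (R : realFieldType) (a b G g Q : R) :
  0 < a -> a <= b -> 0 <= Q -> (Q = 0 -> G = 0) ->
  - (G * (g / b)) <=
    - (G / a * g) + 2^-1 * (G ^+ 2 / Q / a * g ^+ 2) + 2^-1 * Q * (a^-1 - b^-1).
Proof.
move=> a0 ab Q0 QG.
have b0 : 0 < b by apply: lt_le_trans ab.
have [Qz|Qnz] := eqVneq Q 0.
  by rewrite (QG Qz) Qz !mul0r expr0n/= !mul0r !mulr0 mul0r !addr0 oppr0.
have Qp : 0 < Q by rewrite lt_def Qnz.
(* Here [c] = 1 - a / b lies in [0, 1]. Young's inequality leaves Q c^2, and c^2 <= c turns it into
   a multiple of c / a = 1 / a - 1 / b, which telescopes. *)
set c := (b - a) / b.
have c0 : 0 <= c by rewrite divr_ge0 ?subr_ge0// ltW.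
have c1 : c <= 1 by rewrite ler_pdivrMr// mul1r gerBl ltW.
have -> : a^-1 - b^-1 = c / a.
  by rewrite /c; field; rewrite !gt_eqF.
have -> : G * (g / b) = G / a * g - G * g * c / a.
  by rewrite /c; field; rewrite !gt_eqF.
have -> : G ^+ 2 / Q / a * g ^+ 2 = (G * g) ^+ 2 / Q / a.
  by field; rewrite !gt_eqF.
set p := G * g; clearbody p c.
have h : 2 * (p * c) <= p ^+ 2 / Q + Q * c ^+ 2.
  rewrite -subr_ge0 (_ : _ - _ = (p - Q * c) ^+ 2 / Q).
    by rewrite divr_ge0 ?sqr_ge0// ltW.
  by field; rewrite gt_eqF.
have h2 : Q * c ^+ 2 <= Q * c by rewrite ler_wpM2l// expr2 ler_piMr.
have {}h : 2 * (p * c) / a <= (p ^+ 2 / Q + Q * c) / a.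
  by rewrite ler_pM2r ?invr_gt0//; move: h h2; lra.
rewrite -subr_ge0.
rewrite (_ : _ - _ = 2^-1 * ((p ^+ 2 / Q + Q * c) / a - 2 * (p * c) / a)).
  by rewrite mulr_ge0 ?subr_ge0// invr_ge0.
by field; rewrite !gt_eqF.
Qed.

(** Since x^2 - y^2 = 2 x (x - y) - (x - y)^2, this is Young's inequality for the cross term. The
    weight makes the coefficient of x^2 independent of D. *)
Lemma sqr_drift (R : realFieldType) (D x y : R) : 0 < D ->
  D * (x ^+ 2 - y ^+ 2) <= 2^-1 * x ^+ 2 + 2 * D ^+ 2 * (x - y) ^+ 2.
Proof.
move=> D0; have := sqr_ge0 (x - 2 * D * (x - y)).
have := sqr_ge0 (x - y); nra.
Qed.

(** This is ln r <= r - 1 at r = u / v. With v - u = g^2 it makes the sum of g^2 / nu telescope to a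
    logarithm. *)
Lemma log_growth (R : realType) (u v : R) : 0 < u -> u <= v ->
  (v - u) / v <= ln v - ln u.
Proof.
move=> u0 uv; have v0 : 0 < v by apply: lt_le_trans uv.
have := @le_ln1Dx R (u / v - 1).
rewrite ltrBrDr addNr divr_gt0// => /(_ erefl).
rewrite addrC subrK ln_div ?posrE// mulrBl divff ?gt_eqF//.
lra.
Qed.

(** By concavity, ln lies below its tangent at [l]. The bound is affine in x, so expectations pass
    through it, and [l] remains free to be optimized. *)
Lemma ln_tangent (R : realType) (l x : R) : 0 < l -> 0 < x ->
  ln x <= ln l - 1 + x / l.
Proof.
move=> l0 x0; have := @le_ln1Dx R (x / l - 1).
rewrite ltrBrDr addNr divr_gt0// => /(_ erefl).
rewrite addrC subrK ln_div ?posrE//; lra.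
Qed.

(** Both roots on the left are at most S = sqrt (v + c). Hence sqrt v * S <= v + c and sqrt (c + u)
    * S >= c + u; subtract. *)
Lemma sqrt_accumulation (R : rcfType) (u v c : R) : 0 <= u -> u <= v -> 0 <= c ->
  0 < u + c ->
  Num.sqrt v - Num.sqrt (c + u) <= (v - u) / Num.sqrt (v + c).
Proof.
move=> u0 uv c0 uc.
have vc : 0 < v + c by apply: lt_le_trans uc _; rewrite lerD2r.
have s0 : 0 < Num.sqrt (v + c) by rewrite sqrtr_gt0.
rewrite ler_pdivlMr//.
have e1 : Num.sqrt v <= Num.sqrt (v + c) by rewrite ler_wsqrtr// lerDl.
have e2 : Num.sqrt (c + u) <= Num.sqrt (v + c) by rewrite ler_wsqrtr// addrC lerD2r.
have s2 : Num.sqrt (v + c) ^+ 2 = v + c by rewrite sqr_sqrtr// ltW.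
have t2 : Num.sqrt (c + u) ^+ 2 = c + u by rewrite sqr_sqrtr// addrC ltW.
have t0 := sqrtr_ge0 (c + u).
nra.
Qed.

(** * Smoothness and the descent inequality *)

Section smoothness.
Variables (R : realType) (d : nat) (f : 'rV[R]_d -> R) (L : R).
Hypothesis f_diff : forall w, differentiable f w.
Hypothesis f_smooth : forall w w', enorm (grad f w - grad f w') <= L * enorm (w - w').

Lemma enorm_sqr (v : 'rV[R]_d) : enorm v ^+ 2 = \sum_(i < d) v 0 i ^+ 2.
Proof. by rewrite sqr_sqrtr// sumr_ge0// => i _; exact: sqr_ge0. Qed.

Lemma grad_lipschitz_sqr (w w' : 'rV[R]_d) :
  \sum_(i < d) (grad f w 0 i - grad f w' 0 i) ^+ 2 <=
  L ^+ 2 * \sum_(i < d) (w 0 i - w' 0 i) ^+ 2.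
Proof.
have e (u v : 'rV[R]_d) : \sum_(i < d) (u 0 i - v 0 i) ^+ 2 = enorm (u - v) ^+ 2.
  by rewrite enorm_sqr; apply: eq_bigr => i _; rewrite !mxE.
rewrite !e -exprMn ler_sqr ?nnegrE ?sqrtr_ge0//.
by apply: le_trans (f_smooth _ _); exact: sqrtr_ge0.
Qed.

Lemma derive_grad (w v : 'rV[R]_d) :
  'D_v f w = \sum_(i < d) v 0 i * grad f w 0 i.
Proof.
rewrite deriveE// [in LHS](row_sum_delta v) linear_sum; apply: eq_bigr => i _.
by rewrite linearZ/= mxE /partial deriveE.
Qed.

(** The difference quotient along the line at [s] is literally that of [f] at w + s v in direction
    v. *)
Lemma is_derive_segment (w v : 'rV[R]_d) (s : R) :
  is_derive s (1 : R) (fun r : R => f (w + r *: v)) ('D_v f (w + s *: v)).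
Proof.
have e : (fun h : R => h^-1 *: (f (w + (h *: (1 : R) + s) *: v) - f (w + s *: v))) =
         (fun h : R => h^-1 *: (f (h *: v + (w + s *: v)) - f (w + s *: v))).
  by apply: funext => h; rewrite scalerDl /GRing.scale/= mulr1 addrCA.
split; last by rewrite /derive -e.
have : derivable f (w + s *: v) v by exact: diff_derivable.
by rewrite /derivable -e.
Qed.

(** The mean value theorem gives a point of the segment where the gradient differs from that at [w]
    by at most L times the step. Bounding the products by x y <= x^2 + y^2 yields L^2 + 1 in place
    of the sharper L / 2; only the finiteness of the constant matters. *)
Lemma descent (w w' : 'rV[R]_d) :
  f w' - f w <= \sum_(i < d) grad f w 0 i * (w' 0 i - w 0 i) +
    (L ^+ 2 + 1) * \sum_(i < d) (w' 0 i - w 0 i) ^+ 2.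
Proof.
pose v := w' - w.
have dv s : is_derive s (1 : R) (fun r : R => f (w + r *: v)) ('D_v f (w + s *: v)).
  exact: is_derive_segment.
have [|s] := @MVT_segment R (fun r : R => f (w + r *: v))
  (fun s => 'D_v f (w + s *: v)) 0 1 ler01 (fun x _ => dv x).
  apply: derivable_within_continuous => x _; apply: ex_derive.
rewrite in_itv/= => /andP[s0 s1].
have -> : w + 1 *: v = w' by rewrite scale1r addrC subrK.
rewrite scale0r addr0 subr0 mulr1 => ->.
rewrite derive_grad mulr_sumr -big_split/=.
have gl := grad_lipschitz_sqr (w + s *: v) w.
have e : \sum_(i < d) ((w + s *: v) 0 i - w 0 i) ^+ 2 =
    s ^+ 2 * \sum_(i < d) (w' 0 i - w 0 i) ^+ 2.
  by rewrite mulr_sumr; apply: eq_bigr => i _; rewrite !mxE -exprMn; congr (_ ^+ 2); ring.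
rewrite {}e in gl.
have n0 : 0 <= \sum_(i < d) (w' 0 i - w 0 i) ^+ 2.
  by rewrite sumr_ge0// => i _; exact: sqr_ge0.
have gl' : \sum_(i < d) (grad f (w + s *: v) 0 i - grad f w 0 i) ^+ 2 <=
    L ^+ 2 * \sum_(i < d) (w' 0 i - w 0 i) ^+ 2.
  apply: le_trans gl _; rewrite ler_wpM2l ?sqr_ge0// ler_piMl//.
  by rewrite exprn_ile1.
rewrite -subr_ge0 -sumrB.
suff : \sum_(i < d) (grad f (w + s *: v) 0 i - grad f w 0 i) * (w' 0 i - w 0 i) <=
    (L ^+ 2 + 1) * \sum_(i < d) (w' 0 i - w 0 i) ^+ 2.
  rewrite -subr_ge0 mulr_sumr -sumrB => /le_trans; apply.
  rewrite le_eqVlt; apply/orP; left; apply/eqP/eq_bigr => i _.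
  rewrite (_ : v 0 i = w' 0 i - w 0 i) ?mxE//; ring.
apply: (@le_trans _ _ (\sum_(i < d) ((grad f (w + s *: v) 0 i - grad f w 0 i) ^+ 2
    + (w' 0 i - w 0 i) ^+ 2))).
  apply: ler_sum => i _; set x := _ - _; set y := _ - _.
  have := sqr_ge0 (x - y); have := sqr_ge0 (x + y); have := sqr_ge0 x; nra.
by rewrite big_split/= mulrDl mul1r lerD2r.
Qed.

End smoothness.

(** * Deterministic analysis of a single trajectory *)

Section path.
Variables (R : realType) (d : nat) (f : 'rV[R]_d -> R) (L fmin : R).
Hypothesis f_diff : forall w, differentiable f w.
Hypothesis f_smooth : forall w w', enorm (grad f w - grad f w') <= L * enorm (w - w').
Hypothesis f_min : forall w, fmin <= f w.
Variables (eta D0 D1 : R) (w1 nu0 : 'rV[R]_d).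
Hypotheses (eta_gt0 : 0 < eta) (D0_ge0 : 0 <= D0) (D1_gt0 : 0 < D1).
Hypothesis nu0_gt0 : forall l, 0 < nu0 0 l.

(** Costs per unit of sum_l g_l^2 / nu_l: [K0] for the second-order term of [descent], [K3] for the
    drift of the potential. The number [m] dominates every 1 / sqrt nu. *)
Let K0 := (L ^+ 2 + 1) * eta ^+ 2.
Let m := \sum_(i < d) (Num.sqrt (nu0 0 i))^-1.
Let K3 := eta * D1 ^+ 2 * m * (L ^+ 2 * eta ^+ 2).

Let m_ge0 : 0 <= m.
Proof. by apply: sumr_ge0 => i _; rewrite invr_ge0 sqrtr_ge0. Qed.

Let K0_ge0 : 0 <= K0.
Proof. by rewrite mulr_ge0 ?sqr_ge0// addr_ge0// sqr_ge0. Qed.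

Let K3_ge0 : 0 <= K3.
Proof.
apply: mulr_ge0; last by apply: mulr_ge0; exact: sqr_ge0.
by apply: mulr_ge0 => //; apply: mulr_ge0; [exact: ltW|exact: sqr_ge0].
Qed.

Section run.
Variables g nu w : nat -> 'rV[R]_d.
Hypothesis nu_init : nu 0%N = nu0.
Hypothesis w_init : w 1%N = w1.
Hypothesis nuS : forall t l, nu t.+1 0 l = nu t 0 l + g t.+1 0 l ^+ 2.
Hypothesis wS : forall t l,
  w t.+2 0 l = w t.+1 0 l - eta * (g t.+1 0 l / Num.sqrt (nu t.+1 0 l)).

Local Notation G t i := (grad f (w t) 0 i).

Lemma conditioner_le t l : nu t 0 l <= nu t.+1 0 l.
Proof. by rewrite nuS lerDl sqr_ge0. Qed.

Lemma conditioner_ge_init t l : nu0 0 l <= nu t 0 l.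
Proof.
elim: t => [|t IH]; first by rewrite nu_init.
exact: le_trans IH (conditioner_le _ _).
Qed.

Lemma conditioner_gt0 t l : 0 < nu t 0 l.
Proof. exact: lt_le_trans (nu0_gt0 l) (conditioner_ge_init t l). Qed.

Let sq t l : 0 < Num.sqrt (nu t 0 l).
Proof. by rewrite sqrtr_gt0 conditioner_gt0. Qed.

Let e t := \sum_(l < d) g t 0 l ^+ 2 / nu t 0 l.

Let e_ge0 t : 0 <= e t.
Proof. by apply: sumr_ge0 => l _; rewrite divr_ge0 ?sqr_ge0// ltW// conditioner_gt0. Qed.

Lemma step_sqr t : \sum_(l < d) (w t.+2 0 l - w t.+1 0 l) ^+ 2 = eta ^+ 2 * e t.+1.
Proof.
rewrite mulr_sumr; apply: eq_bigr => l _; rewrite wS addrAC subrr add0r sqrrN.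
by rewrite !exprMn exprVn sqr_sqrtr// ltW// conditioner_gt0.
Qed.

Lemma grad_step_sqr t :
  \sum_(i < d) (G t.+2 i - G t.+1 i) ^+ 2 <= L ^+ 2 * (eta ^+ 2 * e t.+1).
Proof. by rewrite -step_sqr; exact: grad_lipschitz_sqr. Qed.

(** As g^2 <= nu, each coordinate moves by at most [eta] per step. The bound grows with t but is the
    same for all trajectories, which is what integrability and pulling out of conditional
    expectations require. *)
Lemma grad_bounded t i :
  `|G t.+1 i| <= `|grad f w1 0 i| + t%:R * Num.sqrt (L ^+ 2 * (eta ^+ 2 * d%:R)).
Proof.
elim: t => [|t IH]; first by rewrite w_init mul0r addr0.
rewrite (_ : G t.+2 i = G t.+1 i + (G t.+2 i - G t.+1 i)); last by rewrite addrC subrK.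
apply: le_trans (ler_normD _ _) _.
rewrite -natr1 mulrDl addrA mul1r; apply: lerD; first exact: IH.
rewrite -[leLHS]sqrtr_sqr ler_wsqrtr//.
apply: (@le_trans _ _ (L ^+ 2 * (eta ^+ 2 * e t.+1))).
  apply: le_trans (grad_step_sqr t).
  by rewrite (bigD1 i)//= lerDl sumr_ge0// => j _; exact: sqr_ge0.
rewrite ler_wpM2l ?sqr_ge0// ler_wpM2l ?sqr_ge0//.
rewrite -[leRHS]mul1r mulr_natr -[X in X%:R]card_ord -sumr_const.
apply: ler_sum => l _; rewrite ler_pdivrMr ?conditioner_gt0// mul1r nuS lerDr.
by rewrite ltW// conditioner_gt0.
Qed.

Let Lam t := \sum_(l < d) ln (nu t 0 l).

Let e_le t : e t.+1 <= Lam t.+1 - Lam t.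
Proof.
rewrite -sumrB; apply: ler_sum => l _.
rewrite (_ : g t.+1 0 l ^+ 2 = nu t.+1 0 l - nu t 0 l); last by rewrite nuS addrC addKr.
by rewrite log_growth ?conditioner_gt0// conditioner_le.
Qed.

(** In conditional mean the first term is eta G^2 / a and the second costs at most half of it. The
    third sets aside a quarter to pay for the drift, so at least eta / 4 times G^2 / a remains. *)
Definition progress t i : R :=
  eta * (G t.+1 i / Num.sqrt (nu t 0 i) * g t.+1 0 i)
  - eta / 2 * (G t.+1 i ^+ 2 / (D0 + D1 * G t.+1 i ^+ 2) / Num.sqrt (nu t 0 i)
               * g t.+1 0 i ^+ 2)
  - eta / 4 * (G t.+1 i ^+ 2 / Num.sqrt (nu t 0 i)).

(** The times of the gradient and of the conditioner are separate: a step advances [s] at fixed [t],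
    and the drift advances [t] at fixed [s]. *)
Let Psi t s := eta / 2 * \sum_(i < d) (D0 + D1 * G t i ^+ 2) / Num.sqrt (nu s 0 i).

Let Psi_ge0 t s : 0 <= Psi t s.
Proof.
apply: mulr_ge0; first by rewrite divr_ge0// ltW.
apply: sumr_ge0 => i _.
by rewrite divr_ge0 ?sqrtr_ge0// addr_ge0// mulr_ge0 ?sqr_ge0// ltW.
Qed.

(** Combines [descent] with [adaptive_step_error] in each coordinate, for the weight Q = D0 + D1
    G^2. The last term is the reserve subtracted in [progress]. *)
Let step_bound t :
  \sum_(i < d) progress t i <=
  f (w t.+1) - f (w t.+2) + (Psi t.+1 t - Psi t.+1 t.+1) + K0 * e t.+1
  - eta / 4 * \sum_(i < d) G t.+1 i ^+ 2 / Num.sqrt (nu t 0 i).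
Proof.
have D := descent f_diff f_smooth (w t.+1) (w t.+2).
rewrite step_sqr mulrA -/K0 in D.
have S : \sum_(i < d) G t.+1 i * (w t.+2 0 i - w t.+1 0 i) <=
   Psi t.+1 t - Psi t.+1 t.+1 - \sum_(i < d) (progress t i +
     eta / 4 * (G t.+1 i ^+ 2 / Num.sqrt (nu t 0 i))).
  rewrite /Psi -mulrBr -sumrB mulr_sumr -sumrB; apply: ler_sum => i _.
  rewrite wS addrAC subrr add0r.
  have := @adaptive_step_error R (Num.sqrt (nu t 0 i)) (Num.sqrt (nu t.+1 0 i))
    (G t.+1 i) (g t.+1 0 i) (D0 + D1 * G t.+1 i ^+ 2).
  move=> /(_ (sq _ _) (ler_wsqrtr (conditioner_le _ _))).
  move=> /(_ (addr_ge0 D0_ge0 (mulr_ge0 (ltW D1_gt0) (sqr_ge0 _)))).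
  have Q0 : D0 + D1 * G t.+1 i ^+ 2 = 0 -> G t.+1 i = 0.
    have G0 : 0 <= D1 * G t.+1 i ^+ 2 by rewrite mulr_ge0 ?sqr_ge0// ltW.
    move/eqP; rewrite paddr_eq0// => /andP[_].
    by rewrite mulf_eq0 gt_eqF//= sqrf_eq0 => /eqP.
  move=> /(_ Q0) /(ler_wpM2l (ltW eta_gt0)).
  rewrite /progress; set A := _ / _ * g _ _ _; set B := _ * g _ _ _ ^+ 2.
  set q := D0 + _; lra.
rewrite big_split/= -mulr_sumr in S.
move: D S; lra.
Qed.

(* Used to absorb the drift of the telescoping sum in the term [eta / 4 * _] that
   [step_bound] keeps in reserve. *)
Let potential_drift t :
  Psi t.+2 t.+1 <= Psi t.+1 t.+1 + K3 * e t.+1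
    + eta / 4 * \sum_(i < d) G t.+2 i ^+ 2 / Num.sqrt (nu t.+1 0 i).
Proof.
apply: (@le_trans _ _ (Psi t.+1 t.+1
    + eta * D1 ^+ 2 * m * \sum_(i < d) (G t.+2 i - G t.+1 i) ^+ 2
    + eta / 4 * \sum_(i < d) G t.+2 i ^+ 2 / Num.sqrt (nu t.+1 0 i))); last first.
  rewrite lerD2r lerD2l /K3 -[leRHS]mulrA ler_wpM2l//; last by rewrite -mulrA grad_step_sqr.
  by apply: mulr_ge0 => //; apply: mulr_ge0; [exact: ltW|exact: sqr_ge0].
rewrite /Psi; set k := eta * D1 ^+ 2 * m.
rewrite !mulr_sumr -!big_split/=; apply: ler_sum => i _.
(* Multiplied by eta / 2, the x^2 term is exactly the reserve eta / 4; the rest has coefficient eta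
   D1^2, and 1 / sqrt nu <= m. *)
have h := sqr_drift (G t.+2 i) (G t.+1 i) D1_gt0.
have im : (Num.sqrt (nu t.+1 0 i))^-1 <= m.
  apply: (@le_trans _ _ (Num.sqrt (nu0 0 i))^-1).
    by rewrite lef_pV2 ?posrE ?sq ?sqrtr_gt0 ?nu0_gt0// ler_wsqrtr// conditioner_ge_init.
  by rewrite /m (bigD1 i)//= lerDl sumr_ge0// => j _; rewrite invr_ge0 sqrtr_ge0.
have i0 : 0 <= (Num.sqrt (nu t.+1 0 i))^-1 by rewrite invr_ge0 sqrtr_ge0.
move: h im i0; set r := (Num.sqrt (nu _ 0 i))^-1; set x := G _ i; set y := G _ i => h im i0.
have h1 := ler_wpM2r i0 h.
have h2 := ler_wpM2l (mulr_ge0 (mulr_ge0 (ltW eta_gt0) (sqr_ge0 D1)) (sqr_ge0 (x - y))) im.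
have h3 := ler_wpM2l (ltW eta_gt0) h1.
rewrite /k; move: h2 h3; set z := (x - y) ^+ 2; clearbody r x y z; lra.
Qed.

Lemma progress_le_log T :
  \sum_(t < T.+1) \sum_(i < d) progress t i <=
  f w1 - fmin + eta / 2 * (\sum_(i < d) (D0 + D1 * grad f w1 0 i ^+ 2) / Num.sqrt (nu0 0 i)) +
  (K0 + K3) * (\sum_(l < d) ln (nu T.+1 0 l) - \sum_(l < d) ln (nu0 0 l)).
Proof.
have -> : eta / 2 * (\sum_(i < d) (D0 + D1 * grad f w1 0 i ^+ 2) / Num.sqrt (nu0 0 i))
  = Psi 1 0 by rewrite /Psi w_init nu_init.
have -> : \sum_(l < d) ln (nu0 0 l) = Lam 0 by rewrite /Lam nu_init.
rewrite -/(Lam T.+1).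
(* The induction keeps the final values of [f] and [Psi]. There are T + 1 steps but only T drifts
   between them, so [K3] comes with [Lam T]. *)
suff H : \sum_(t < T.+1) \sum_(i < d) progress t i <=
  f w1 - f (w T.+2) + Psi 1 0 - Psi T.+1 T.+1 + K0 * (Lam T.+1 - Lam 0)
  + K3 * (Lam T - Lam 0).
  have h1 := f_min (w T.+2).
  have h2 := Psi_ge0 T.+1 T.+1.
  have h3 : K3 * (Lam T - Lam 0) <= K3 * (Lam T.+1 - Lam 0).
    rewrite ler_wpM2l// lerD2r.
    by rewrite -subr_ge0; exact: le_trans (e_ge0 _) (e_le _).
  move: H h1 h2 h3; lra.
have q1 t : 0 <= eta / 4 * \sum_(i < d) G t.+1 i ^+ 2 / Num.sqrt (nu t 0 i).
  apply: mulr_ge0; first by rewrite divr_ge0// ltW.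
  apply: sumr_ge0 => i _; by rewrite divr_ge0 ?sqr_ge0// sqrtr_ge0.
have q2 t := ler_wpM2l K0_ge0 (e_le t).
have q3 t := ler_wpM2l K3_ge0 (e_le t).
elim: T => [|T IH].
  rewrite big_ord_recr big_ord0/= add0r.
  have := step_bound 0; have := q1 0; have := q2 0; rewrite w_init; lra.
rewrite big_ord_recr/=.
have := step_bound T.+1; have := potential_drift T; have := q2 T.+1; have := q3 T.
move: IH; lra.
Qed.

End run.

(** Writes ln nu = 2 ln (sqrt nu) and applies [ln_tangent] at [lam]. The constants precede the
    trajectory, so they are uniform over outcomes. The factor d + 1 covers both the d copies of ln
    lam and the single sum of roots. *)
Lemma progress_bound : exists c K : R, 0 <= K /\
  forall g nu w : nat -> 'rV[R]_d,
    nu 0%N = nu0 -> w 1%N = w1 ->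
    (forall t l, nu t.+1 0 l = nu t 0 l + g t.+1 0 l ^+ 2) ->
    (forall t l, w t.+2 0 l =
       w t.+1 0 l - eta * (g t.+1 0 l / Num.sqrt (nu t.+1 0 l))) ->
    forall (T : nat) (lam : R), 1 <= lam ->
    \sum_(t < T.+1) \sum_(i < d) progress g nu w t i <=
      c + K * (ln lam + (\sum_(l < d) Num.sqrt (nu T.+1 0 l)) / lam).
Proof.
exists (f w1 - fmin +
  eta / 2 * (\sum_(i < d) (D0 + D1 * grad f w1 0 i ^+ 2) / Num.sqrt (nu0 0 i)) -
  (K0 + K3) * \sum_(l < d) ln (nu0 0 l)), ((K0 + K3) * (2 * d.+1%:R)).
split; first by rewrite mulr_ge0// addr_ge0.
move=> g nu w nu_init w_init nuS wS T lam lam1.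
have lam0 : 0 < lam by apply: lt_le_trans lam1.
apply: le_trans (progress_le_log nu_init w_init nuS wS T) _.
rewrite [leRHS]addrAC mulrBr addrA lerD2r lerD2l -[leRHS]mulrA.
apply: ler_wpM2l; first by rewrite addr_ge0.
apply: (@le_trans _ _ (\sum_(l < d) 2 * (ln lam + Num.sqrt (nu T.+1 0 l) / lam))).
  apply: ler_sum => l _.
  have n0 := conditioner_gt0 nu_init nuS T.+1 l.
  have s0 : 0 < Num.sqrt (nu T.+1 0 l) by rewrite sqrtr_gt0.
  rewrite -[X in ln X](sqr_sqrtr (ltW n0)) lnXn// -[ln _ *+ 2]mulr_natl ler_wpM2l//.
  by apply: le_trans (ln_tangent lam0 s0) _; rewrite lerD2r gerBl.
rewrite -mulr_sumr -mulrA ler_wpM2l// big_split/= sumr_const card_ord -mulr_suml.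
have ln0 : 0 <= ln lam by exact: ln_ge0.
have S0 : 0 <= (\sum_(l < d) Num.sqrt (nu T.+1 0 l)) / lam.
  by rewrite divr_ge0 ?(ltW lam0)// sumr_ge0// => l _; exact: sqrtr_ge0.
rewrite mulrDr -[ln lam *+ d]mulr_natl; apply: lerD.
  by rewrite ler_wpM2r// ler_nat.
by rewrite ler_peMl// ler1n.
Qed.

(** After [sqrt_accumulation] between times 0 and T, the final conditioner in the denominator is
    replaced by the smaller one preceding each gradient, so that every weight is known before its
    gradient is drawn. *)
Lemma sqrt_conditioner_le (g nu : nat -> 'rV[R]_d) (T : nat) (c : R) (l : 'I_d) :
  nu 0%N = nu0 -> (forall t l, nu t.+1 0 l = nu t 0 l + g t.+1 0 l ^+ 2) ->
  0 <= c ->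
  Num.sqrt (nu T 0 l) - (Num.sqrt c + Num.sqrt (nu0 0 l)) <=
  \sum_(t < T) (Num.sqrt (nu t 0 l + c))^-1 * g t.+1 0 l ^+ 2.
Proof.
move=> nu_init nuS c0.
have n0 t := conditioner_gt0 nu_init nuS t l.
apply: (@le_trans _ _ (Num.sqrt (nu T 0 l) - Num.sqrt (c + nu0 0 l))).
  rewrite lerD2l lerN2 -(@ler_pXn2r _ 2)// ?nnegrE ?addr_ge0 ?sqrtr_ge0//.
  rewrite sqrrD !sqr_sqrtr ?addr_ge0// ?(ltW (nu0_gt0 l))//.
  by rewrite addrAC lerDl mulrn_wge0// mulr_ge0// sqrtr_ge0.
apply: le_trans (sqrt_accumulation (ltW (nu0_gt0 l))
  (conditioner_ge_init nu_init nuS T l) c0 _) _.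
  by rewrite ltr_wpDr.
have mono s k : nu s 0 l <= nu (s + k)%N 0 l.
  elim: k => [|k IH]; first by rewrite addn0.
  by rewrite addnS; apply: le_trans IH (conditioner_le nuS _ _).
have -> : nu T 0 l - nu0 0 l = \sum_(t < T) g t.+1 0 l ^+ 2.
  elim: T => [|T IH]; first by rewrite big_ord0 nu_init subrr.
  by rewrite big_ord_recr/= -IH nuS addrAC.
rewrite mulr_suml; apply: ler_sum => t _; rewrite mulrC ler_wpM2r ?sqr_ge0//.
have p s : 0 < nu s 0 l + c by rewrite ltr_wpDr.
rewrite lef_pV2 ?posrE ?sqrtr_gt0// ler_wsqrtr// lerD2r.
by have := mono t (T - t)%N; rewrite subnKC// ltnW.
Qed.
End path.

(** * Real-valued expectations and Markov's inequality *)

Section real_expectation.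
Context (R : realType) (disp : measure_display) (Omega : measurableType disp).
Variable P : probability Omega R.

Local Notation integrableR X := (P.-integrable [set: Omega] (EFin \o X)).

Lemma integrableR_add (X Y : Omega -> R) : integrableR X -> integrableR Y ->
  integrableR (fun x => X x + Y x).
Proof. by move=> iX iY; have := integrableD measurableT iX iY. Qed.

Lemma integrableR_scale (k : R) (X : Omega -> R) : integrableR X ->
  integrableR (fun x => k * X x).
Proof. by move=> iX; have := integrableZl measurableT k iX. Qed.

Lemma integrableR_cst (k : R) : integrableR (fun=> k).
Proof. exact: finite_measure_integrable_cst. Qed.

Lemma integrableR_sum (I : Type) (s : seq I) (X : I -> Omega -> R) :
  (forall i, integrableR (X i)) -> integrableR (fun x => \sum_(i <- s) X i x).
Proof.
move=> iX; elim: s => [|i s IH].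
  by under eq_fun do rewrite big_nil; exact: integrableR_cst.
by under eq_fun do rewrite big_cons; exact: integrableR_add.
Qed.

Lemma Rintegral_sum (I : Type) (s : seq I) (X : I -> Omega -> R) :
  (forall i, integrableR (X i)) ->
  \int[P]_x (\sum_(i <- s) X i x) = \sum_(i <- s) \int[P]_x X i x.
Proof.
move=> iX; elim: s => [|i s IH].
  under eq_Rintegral do rewrite big_nil.
  by rewrite Rintegral_cst// mul0r big_nil.
under eq_Rintegral do rewrite big_cons.
by rewrite RintegralD//= ?IH ?big_cons//; exact: integrableR_sum.
Qed.

Lemma Rintegral_prob_cst (k : R) : \int[P]_x k = k.
Proof.
rewrite Rintegral_cst// (_ : fine _ = 1) ?mulr1//.
by have /= -> := @probability_setT _ _ _ P.
Qed.

Lemma integrableR_measurable (X : Omega -> R) : integrableR X -> measurable_fun setT X.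
Proof. by move=> /measurable_int/measurable_EFinP. Qed.

Lemma integrableR_bddM (M : R) (Z X : Omega -> R) : measurable_fun setT Z ->
  (forall x, `|Z x| <= M) -> integrableR X -> integrableR (fun x => Z x * X x).
Proof.
move=> mZ bZ iX.
apply: (le_integrable measurableT _ _ (integrableR_scale M iX)).
  apply/measurable_EFinP; apply: measurable_funM => //.
  exact: integrableR_measurable.
move=> x _ /=; rewrite lee_fin !normrM ler_wpM2r//.
by apply: le_trans (bZ x) _; exact: ler_norm.
Qed.

Lemma integrableR_bdd (M : R) (Z : Omega -> R) : measurable_fun setT Z ->
  (forall x, `|Z x| <= M) -> integrableR Z.
Proof.
move=> mZ bZ; have := integrableR_bddM mZ bZ (integrableR_cst 1).
by congr (P.-integrable _ _); apply: funext => x /=; rewrite mulr1.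
Qed.

Lemma Rintegral_markov (X : Omega -> R) (k : R) : 0 < k -> integrableR X ->
  (forall x, 0 <= X x) ->
  (P [set x | (k <= X x)%R] <= (\int[P]_x X x / k)%:E)%E.
Proof.
move=> k0 iX X0; set A := [set x | _].
have mX := integrableR_measurable iX.
have mA : measurable A.
  by rewrite -[X in measurable X]setTI; exact: measurable_fun_le.
have iA : integrableR (\1_A : Omega -> R).
  apply: (@integrableR_bdd 1) => // x.
  by rewrite indicE normr_nat; case: (_ \in _).
have PA : (P A = (\int[P]_x \1_A x)%:E)%E.
  rewrite /Rintegral integral_indic// setIT fineK//.
  exact: fin_num_measure.
rewrite PA lee_fin ler_pdivlMr// mulrC -RintegralZl//.
apply: le_Rintegral => //; first exact: integrableR_scale.
move=> x _; rewrite indicE; have [xA|xA] := boolP (x \in A).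
  by rewrite mulr1; move: xA; rewrite inE.
by rewrite mulr0.
Qed.

(** On nonnegative reals the inverse is the power -1, also at 0, where both take the default value
    0. *)
Lemma measurable_fun_inv_ge0 (d' : measure_display) (T : measurableType d')
  (X : T -> R) : (forall x, 0 <= X x) -> measurable_fun setT X ->
  measurable_fun setT (fun x => (X x)^-1).
Proof.
move=> X0 mX; rewrite (_ : (fun x => _) = (@powR R ^~ (-1)) \o X).
  exact/measurableT_comp.
by apply: funext => x /=; rewrite powR_inv1.
Qed.

Lemma measurable_fun_sqrt (d' : measure_display) (T : measurableType d')
  (X : T -> R) : measurable_fun setT X ->
  measurable_fun setT (fun x => Num.sqrt (X x)).
Proof.
move=> mX; apply: (measurableT_comp (f := @Num.sqrt R)) => //.
by apply: continuous_measurable_fun; exact: sqrt_continuous.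
Qed.

(** * Pulling bounded factors out of conditional expectations *)

Section sub_sigma_algebra.
Variable H : set (set Omega).
Hypothesis H_sub : <<s H >> `<=` @measurable _ Omega.

Local Notation pre := (measurable_fun (T := g_sigma_algebraType H) [set: Omega]).

Lemma sub_measurable (Z : Omega -> R) : pre Z -> measurable_fun [set: Omega] Z.
Proof.
by move=> mZ _ B mB; apply: H_sub; exact: (mZ measurableT B mB).
Qed.

Variables X Y : Omega -> R.
Hypothesis XY : is_cond_expectation P <<s H >> X Y.

Let iX : integrableR X. Proof. by case: XY. Qed.
Let iY : integrableR Y. Proof. by case: XY. Qed.

Lemma cond_expectation_measurable : pre Y.
Proof.
by case: XY => _ _ hY _ _ B mB; apply: hY; exists B.
Qed.

Lemma cond_expectation_indic (A : set Omega) : <<s H >> A ->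
  \int[P]_x (\1_A x * X x) = \int[P]_x (\1_A x * Y x).
Proof.
have e (Z : Omega -> R) : \int[P]_x (\1_A x * Z x) = \int[P]_(x in A) Z x.
  rewrite [RHS]Rintegral_mkcond; apply: eq_Rintegral => x _.
  by rewrite patchE indicE; case: ifP; rewrite ?mul1r ?mul0r.
by case: XY => _ _ _ + hA => /(_ A hA); rewrite !e /Rintegral => ->.
Qed.

(* Bisection: passing from [Z] to [Z - M / 2 * \1_[M / 2 <= Z]] halves the range
   and does not change the difference of the two integrals. *)
Let halving n (Z : Omega -> R) (M : R) : pre Z -> (forall x, 0 <= Z x <= M) ->
  `|\int[P]_x (Z x * X x) - \int[P]_x (Z x * Y x)| <=
  M / 2 ^+ n * (\int[P]_x `|X x| + \int[P]_x `|Y x|).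
Proof.
have bZ (Z' : Omega -> R) (M' : R) : (forall x, 0 <= Z' x <= M') -> forall x, `|Z' x| <= M'.
  by move=> h x; have /andP[? ?] := h x; rewrite ger0_norm.
elim: n Z M => [|n IH] Z M mZ hZ.
  rewrite expr0 divr1 mulrDr; apply: le_trans (ler_normB _ _) _.
  have one W : integrableR W -> `|\int[P]_x (Z x * W x)| <= M * \int[P]_x `|W x|.
    move=> iW; have iZW := integrableR_bddM (sub_measurable mZ) (bZ _ _ hZ) iW.
    have inW : integrableR (fun x => `|W x|).
      by have := integrable_norm iW.
    apply: le_trans (le_normr_Rintegral measurableT iZW) _.
    rewrite -RintegralZl//; apply: le_Rintegral => //.
    - by have := integrable_norm iZW.
    - exact: integrableR_scale.
    - by move=> x _; rewrite normrM ler_wpM2r// bZ.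
  by apply: lerD; exact: one.
pose A := [set x : Omega | M / 2 <= Z x].
have hA : <<s H >> A.
  have := measurable_fun_le (T := g_sigma_algebraType H) measurableT
    (measurable_cst (M / 2)) mZ.
  by rewrite setTI.
have mA : pre (\1_A : Omega -> R).
  exact: (@measurable_indic _ (g_sigma_algebraType H)).
pose Z' x := Z x - M / 2 * \1_A x.
have mZ' : pre Z'.
  by apply: measurable_funB => //; apply: measurable_funM.
have hZ' x : 0 <= Z' x <= M / 2.
  rewrite /Z' indicE; have := hZ x.
  have [xA|xA] := boolP (x \in A).
    by move: xA; rewrite inE /A/=; lra.
  by move: xA; rewrite notin_setE /A/= => /negP; rewrite -ltNge; lra.
have split W : integrableR W ->
    \int[P]_x (Z x * W x) = \int[P]_x (Z' x * W x) + M / 2 * \int[P]_x (\1_A x * W x).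
  move=> iW.
  have i1 : integrableR (fun x => \1_A x * W x).
    apply: (@integrableR_bddM 1) => //; first exact: sub_measurable.
    by move=> x; rewrite indicE normr_nat; case: (_ \in _).
  rewrite -RintegralZl// -RintegralD//.
  - by apply: eq_Rintegral => x _; rewrite /Z'; ring.
  - by apply: (integrableR_bddM (sub_measurable mZ') (bZ Z' (M / 2) hZ')).
  - exact: integrableR_scale.
rewrite !split// (cond_expectation_indic hA) opprD addrACA subrr addr0.
by apply: le_trans (IH _ _ mZ' hZ') _; rewrite exprS invfM mulrA.
Qed.

(** The definition tests indicators only. For 0 <= Z <= N, [halving] makes the gap smaller than any
    positive number; the general case follows by adding the constant M to Z. *)
Lemma cond_expectation_pullout (Z : Omega -> R) (M : R) :
  pre Z -> (forall x, `|Z x| <= M) ->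
  \int[P]_x (Z x * X x) = \int[P]_x (Z x * Y x).
Proof.
have ge0 (W : Omega -> R) (N : R) : pre W -> (forall x, 0 <= W x <= N) ->
    \int[P]_x (W x * X x) = \int[P]_x (W x * Y x).
  move=> mW hW; apply/eqP; rewrite -subr_eq0 -normr_le0.
  set c := \int[P]_x `|X x| + \int[P]_x `|Y x|.
  have c0 : 0 <= c by rewrite addr_ge0// Rintegral_ge0.
  rewrite leNgt; apply/negP => e0; set e := `| _ | in e0.
  have N0 : 0 <= N by have /andP[] := hW point; exact: le_trans.
  (* For this n, 2^n exceeds N c / e, so [halving] contradicts a gap e > 0. *)
  pose n := Num.Def.archi_bound (N * c / e).
  have hn : N * c / e < 2 ^+ n by exact: upper_nthrootP.
  have := halving n mW hW; rewrite -/c -/e mulrAC ler_pdivlMr ?exprn_gt0//.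
  by apply/negP; rewrite -ltNge [ltRHS]mulrC -ltr_pdivrMr.
move=> mZ bZ; pose W x := Z x + M.
have mW : pre W by exact: measurable_funD.
have hW x : 0 <= W x <= M + M.
  by have := bZ x; rewrite ler_norml /W => /andP[? ?]; apply/andP; split; lra.
have e V : integrableR V ->
    \int[P]_x (W x * V x) = \int[P]_x (Z x * V x) + M * \int[P]_x V x.
  move=> iV; rewrite -RintegralZl// -RintegralD//.
  - by apply: eq_Rintegral => x _; rewrite /W mulrDl.
  - exact: (integrableR_bddM (sub_measurable mZ) bZ).
  - exact: integrableR_scale.
have E0 : \int[P]_x X x = \int[P]_x Y x.
  have := @cond_expectation_indic setT (@measurableT _ (g_sigma_algebraType H)).
  by under eq_Rintegral do rewrite indicT mul1r; under [RHS]eq_Rintegral do rewrite indicT mul1r.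
have := ge0 _ _ mW hW; rewrite !e// E0; exact: addIr.
Qed.

End sub_sigma_algebra.

(** Almost everywhere X = |X|, whose integral is nonnegative. *)
Lemma Rintegral_ae_ge0 (X : Omega -> R) : integrableR X ->
  {ae P, forall x, 0 <= X x} -> 0 <= \int[P]_x X x.
Proof.
move=> iX X0.
have -> : \int[P]_x X x = \int[P]_x `|X x|; last exact: Rintegral_ge0.
congr fine; apply: ae_eq_integral => //.
- exact: measurable_int iX.
- by have /measurable_int := integrable_norm iX.
- by apply: filterS X0 => x X0 _; rewrite ger0_norm.
Qed.

(** Pull Z out to reach the version V, then compare V with W almost surely. This is how the variance
    bound is used. *)
Lemma cond_expectation_pullout_le (H : set (set Omega)) (X V W Z : Omega -> R) (M : R) :
  <<s H >> `<=` @measurable _ Omega ->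
  is_cond_expectation P <<s H >> X V ->
  integrableR W -> {ae P, forall x, V x <= W x} ->
  measurable_fun (T := g_sigma_algebraType H) [set: Omega] Z ->
  (forall x, 0 <= Z x <= M) ->
  \int[P]_x (Z x * X x) <= \int[P]_x (Z x * W x).
Proof.
move=> H_sub XV iW VW mZ hZ.
have bZ x : `|Z x| <= M by have /andP[? ?] := hZ x; rewrite ger0_norm.
have mZ' := sub_measurable H_sub mZ.
have iV : integrableR V by case: XV.
rewrite (cond_expectation_pullout H_sub XV mZ bZ).
have iZV := integrableR_bddM mZ' bZ iV.
have iZW := integrableR_bddM mZ' bZ iW.
rewrite -subr_ge0 -RintegralB//; apply: Rintegral_ae_ge0.
  by have := integrableB measurableT iZW iZV.
apply: filterS VW => x VW; rewrite -mulrBr mulr_ge0 ?subr_ge0//.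
by have /andP[] := hZ x.
Qed.
End real_expectation.

(** * Solving the coupled inequalities *)

(** The free [lam] is used twice: a constant value bounds S linearly in s, and then lam = 1 + s
    bounds A logarithmically. *)
Lemma self_bounding_rates (R : realType) (al c K c2 k D : R) :
  0 < al -> 0 <= K -> 0 <= k -> 0 < D ->
  exists CS CA : R, [/\ 0 < CS, 0 < CA & forall s S A : R,
    0 <= s -> 0 <= S -> 0 <= A -> S <= c2 + k * s + D * A ->
    (forall lam, 1 <= lam -> al * A <= c + K * (ln lam + S / lam)) ->
    S <= CS * (1 + s) /\ A <= CA * (1 + ln (1 + s))].
Proof.
move=> al0 K0 k0 D0.
(* Chosen so that the coefficient D K / (al lam0) of S is at most 1/2 and can be absorbed on the
   left. *)
pose lam0 := 1 + 2 * (D * K / al).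
have DK0 : 0 <= D * K / al by rewrite divr_ge0 ?(ltW al0)// mulr_ge0// ltW.
have lam1 : 1 <= lam0 by rewrite lerDl mulr_ge0.
have lam00 : 0 < lam0 by apply: lt_le_trans lam1.
pose B := D * (c + K * ln lam0) / al.
pose CS := 1 + 2 * (`|c2| + `|B|) + 2 * k.
pose CA := 1 + (`|c| + K * CS + K) / al.
have CS1 : 1 <= CS by rewrite /CS -addrA lerDl addr_ge0// mulr_ge0// addr_ge0.
have CA1 : 1 <= CA.
  rewrite lerDl divr_ge0 ?(ltW al0)// !addr_ge0// mulr_ge0//.
  exact: le_trans CS1.
exists CS, CA; split; [exact: lt_le_trans CS1|exact: lt_le_trans CA1|].
move=> s S A s0 S0 A0 hS hA.
have half : D * K / al / lam0 <= 2^-1.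
  rewrite ler_pdivrMr// /lam0; move: DK0; set z := D * K / al; lra.
have S1 : S <= CS * (1 + s).
  have := hA _ lam1; rewrite mulrC -ler_pdivlMr// => hA1.
  have := ler_wpM2l (ltW D0) hA1.
  rewrite [leRHS](_ : _ = B + D * K / al / lam0 * S); last first.
    rewrite /B; move: (lam0) lam00 => l l0; move: (ln l) => ll.
    by field; rewrite !gt_eqF.
  move=> hA2.
  have h3 := ler_wpM2r S0 half.
  have h4 := ler_norm B; have h5 := ler_norm c2.
  have h6 : 0 <= `|B| by []. have h7 : 0 <= `|c2| by [].
  have h8 : 0 <= k * s by rewrite mulr_ge0.
  have h9 : 0 <= (`|c2| + `|B|) * s by rewrite mulr_ge0// addr_ge0.
  move: hS hA2 h3 h4 h5 h6 h7 h8 h9 s0 k0; rewrite /CS.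
  set u := D * K / al / lam0 * S; set v := D * A.
  set b := `|B|; set e := `|c2|; clearbody u v b e; lra.
split=> //.
have s1 : 1 <= 1 + s by rewrite lerDl.
have s10 : 0 < 1 + s by apply: lt_le_trans s1.
have l0 := ln_ge0 s1.
(* With lam = 1 + s, the first bound gives S / lam <= CS, leaving only ln (1 + s). *)
have := hA _ s1; rewrite mulrC -ler_pdivlMr// => /le_trans; apply.
have h : S / (1 + s) <= CS by rewrite ler_pdivrMr.
have h1 := ler_wpM2l K0 h.
have h2 := ler_norm c.
have h3 : 0 <= `|c| * ln (1 + s) by rewrite mulr_ge0.
have h4 : 0 <= K * CS * ln (1 + s) by rewrite !mulr_ge0// (le_trans _ CS1).
rewrite ler_pdivrMr// /CA mulrAC mulrDl mul1r divfK ?gt_eqF//.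
have h5 : 0 <= al * (1 + ln (1 + s)) by rewrite mulr_ge0 ?(ltW al0)// addr_ge0.
have h6 : 0 <= K * ln (1 + s) by rewrite mulr_ge0.
move: h1 h2 h3 h4 h5 h6; rewrite !mulrDr !mulrDl; set e := `|c|; set l := ln _.
set q := S / _; lra.
Qed.

(** * Minima over time and the tail of a product *)

Lemma min_upto_le (R : realType) (a : nat -> R) (n t : nat) :
  (1 <= t <= n)%N -> min_upto a n <= a t.
Proof.
move=> tn; have : t \in index_iota 1 n.+1 by rewrite mem_index_iota ltnS.
rewrite /min_upto; elim: (index_iota _ _) => //= s r IH.
rewrite inE big_cons ge_min => /orP[/eqP ->|/IH ->]; first by rewrite lexx.
by rewrite orbT.
Qed.

Lemma measurable_min_upto (R : realType) (disp : measure_display)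
  (T : measurableType disp) (h : T -> nat -> R) (n : nat) :
  (forall t, (1 <= t)%N -> measurable_fun setT (fun x => h x t)) ->
  measurable_fun setT (fun x => min_upto (h x) n).
Proof.
move=> mh; rewrite /min_upto.
have : all (leq 1) (index_iota 1 n.+1).
  by apply/allP => t; rewrite mem_index_iota => /andP[].
elim: (index_iota _ _) => [_|t r IH /=/andP[t1 hr]].
  by under eq_fun do rewrite big_nil; exact: mh.
under eq_fun do rewrite big_cons; apply: measurable_minr; [exact: mh|exact: IH].
Qed.

(** A single use of Markov's inequality for Z = X / a + Y / b, of mean at most 2, gives Z < 2 /
    delta outside an event of probability at most delta. There X Y / (a b) <= (Z / 2)^2 <= 1 /
    delta^2. *)
Lemma product_markov (R : realType) (disp : measure_display)
  (Omega : measurableType disp) (P : probability Omega R) (X Y : Omega -> R)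
  (a b delta : R) :
  P.-integrable [set: Omega] (EFin \o X) -> P.-integrable [set: Omega] (EFin \o Y) ->
  (forall x, 0 <= X x) -> (forall x, 0 <= Y x) -> 0 < a -> 0 < b ->
  \int[P]_x X x <= a -> \int[P]_x Y x <= b -> 0 < delta ->
  ((1 - delta)%:E <= P [set x | (X x * Y x <= a * b / delta ^+ 2)%R])%E.
Proof.
move=> iX iY X0 Y0 a0 b0 Xa Yb d0.
pose Z x := a^-1 * X x + b^-1 * Y x.
have iaX := integrableR_scale a^-1 iX.
have ibY := integrableR_scale b^-1 iY.
have iZ : P.-integrable [set: Omega] (EFin \o Z) by exact: integrableR_add.
have Z0 x : 0 <= Z x by rewrite addr_ge0// mulr_ge0// invr_ge0 ltW.
have EZ : \int[P]_x Z x <= 2.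
  rewrite RintegralD// !RintegralZl// -[2]/(1 + 1); apply: lerD.
    by rewrite mulrC ler_pdivrMr// mul1r.
  by rewrite mulrC ler_pdivrMr// mul1r.
pose A := [set x | 2 / delta <= Z x].
have mA : measurable A.
  rewrite -[X in measurable X]setTI; apply: measurable_fun_le => //.
  exact: integrableR_measurable iZ.
have PA : (P A <= delta%:E)%E.
  apply: le_trans (Rintegral_markov _ iZ Z0) _; first by rewrite divr_gt0.
  by rewrite lee_fin ler_pdivrMr ?divr_gt0// mulrC divfK ?gt_eqF.
have PC : ((1 - delta)%:E <= P (~` A))%E.
  rewrite probability_setC// EFinB; exact: leeB.
apply: (le_trans PC).
apply: le_measure; rewrite ?inE//.
- exact: measurableC.
- rewrite -[X in measurable X]setTI; apply: measurable_fun_le => //.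
  exact: measurable_funM (integrableR_measurable iX) (integrableR_measurable iY).
move=> x /= /negP; rewrite -ltNge => hZ.
have Zd : Z x * delta <= 2 by rewrite -ler_pdivlMr// ltW.
have -> : X x * Y x = a * b * ((a^-1 * X x) * (b^-1 * Y x)).
  by field; rewrite !gt_eqF.
apply: ler_wpM2l; first by rewrite ltW// mulr_gt0.
rewrite -[leRHS]mul1r ler_pdivlMr ?exprn_gt0//.
set p := a^-1 * X x; set q := b^-1 * Y x.
have h1 : 0 <= (p - q) ^+ 2 * delta ^+ 2 by rewrite mulr_ge0// sqr_ge0.
have h2 : (Z x * delta) ^+ 2 <= 2 ^+ 2.
  by rewrite ler_pXn2r ?nnegrE// mulr_ge0// ltW.
rewrite -subr_ge0.
have -> : 1 - p * q * delta ^+ 2 =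
  ((2 ^+ 2 - (Z x * delta) ^+ 2) + (p - q) ^+ 2 * delta ^+ 2) / 4.
  by rewrite /Z -/p -/q; field.
by rewrite divr_ge0// addr_ge0// subr_ge0.
Qed.

(** * Expectation bounds for AdaGrad and the final rate *)

Section adagrad_expectation.
Variables (R : realType) (d : nat) (f : 'rV[R]_d -> R) (L : R).
Hypothesis f_diff : forall w, differentiable f w.
Hypothesis f_smooth : forall w w', enorm (grad f w - grad f w') <= L * enorm (w - w').
Variables (eta : R) (w1 nu0 : 'rV[R]_d).
Hypotheses (eta_gt0 : 0 < eta) (nu0_gt0 : forall l, 0 < nu0 0 l).
Variables (disp : measure_display) (Omega : measurableType disp)
  (P : probability Omega R) (g nu w : nat -> Omega -> 'rV[R]_d).
Hypothesis g_measurable : forall t (i : 'I_d), (1 <= t)%N ->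
  measurable_fun [set: Omega] (fun x => g t x 0 i).
Hypothesis gen : adagrad eta w1 nu0 g nu w.
Hypothesis unbiased : forall t (i : 'I_d), (1 <= t)%N ->
  is_cond_expectation P (past g t)
    (fun x => g t x 0 i) (fun x => grad f (w t x) 0 i).
Variables D0 D1 : R.
Hypotheses (D0_ge0 : 0 <= D0) (D1_gt0 : 0 < D1).
Hypothesis affine_variance : forall t (i : 'I_d), (1 <= t)%N ->
  exists V : Omega -> R,
    is_cond_expectation P (past g t) (fun x => `|g t x 0 i| ^+ 2) V /\
    {ae P, forall x, V x <= D0 + D1 * (partial f i (w t x)) ^+ 2}.

Local Notation integrableR X := (P.-integrable [set: Omega] (EFin \o X)).

Lemma adagrad_nu_init x : nu 0%N x = nu0.
Proof. by have [] := gen x. Qed.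

Lemma adagrad_w_init x : w 1%N x = w1.
Proof. by have [] := gen x. Qed.

Lemma adagrad_nuS x t l : nu t.+1 x 0 l = nu t x 0 l + g t.+1 x 0 l ^+ 2.
Proof. by have [_ _ /(_ t.+1 l isT)[]] := gen x. Qed.

Lemma adagrad_wS x t l : w t.+2 x 0 l =
  w t.+1 x 0 l - eta * (g t.+1 x 0 l / Num.sqrt (nu t.+1 x 0 l)).
Proof. by have [_ _ /(_ t.+1 l isT)[]] := gen x. Qed.

Let nu_init := adagrad_nu_init.
Let nuS := adagrad_nuS.

Let nu_gt0 x t l : 0 < nu t x 0 l.
Proof.
exact: (@conditioner_gt0 R d nu0 nu0_gt0 (g ^~ x) (nu ^~ x) (nu_init x) (nuS x)).
Qed.

Let nu_ge x t l : nu0 0 l <= nu t x 0 l.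
Proof.
exact: (@conditioner_ge_init R d nu0 (g ^~ x) (nu ^~ x) (nu_init x) (nuS x)).
Qed.

(* [past g t] is convertible to [<<s past_generator t >>]. *)
Definition past_generator t : set (set Omega) :=
  [set A | exists s (i : 'I_d), (1 <= s < t)%N /\
     preimage_set_system [set: Omega] (fun x => g s x 0 i) (@measurable _ R) A].

Lemma past_sub t : <<s past_generator t >> `<=` @measurable _ Omega.
Proof.
apply: smallest_sub; first exact: sigma_algebra_measurable.
move=> A [s [i [/andP[s1 _] [B mB <-]]]]; exact: g_measurable.
Qed.

Local Notation pre t :=
  (measurable_fun (T := g_sigma_algebraType (past_generator t)) [set: Omega]).

Lemma past_nu t s i : (s < t)%N -> pre t (fun x => nu s x 0 i).
Proof.
elim: s => [_|s IH st].
  by rewrite (_ : (fun x => _) = cst (nu0 0 i))//; apply: funext => x; rewrite nu_init.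
under eq_fun do rewrite nuS.
apply: measurable_funD; first by apply: IH; exact: ltnW.
apply: measurable_funX => _ B mB; apply: sub_sigma_algebra.
by exists s.+1, i; split=> //; exists B.
Qed.

(** Times are shifted to start at 0: [gr t] and [nu t] are both known before [g t.+1] is drawn. *)
Let gr t i x := grad f (w t.+1 x) 0 i.
Let G2 t i x := gr t i x ^+ 2 / Num.sqrt (nu t x 0 i).

(** Read off from [unbiased]: a version of the conditional expectation is measurable for the
    past. *)
Let past_gr t i : pre t.+1 (gr t i).
Proof.
exact: (cond_expectation_measurable (H := past_generator t.+1) (unbiased i (ltn0Sn t))).
Qed.

Let past_invsqrt t i (c : R) : 0 <= c ->
  pre t.+1 (fun x => (Num.sqrt (nu t x 0 i + c))^-1).
Proof.
move=> c0; apply: measurable_fun_inv_ge0 => [x|]; first exact: sqrtr_ge0.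
apply: measurable_fun_sqrt; apply: measurable_funD; last exact: measurable_cst.
exact: past_nu.
Qed.

Let past_inv t i : pre t.+1 (fun x => (Num.sqrt (nu t x 0 i))^-1).
Proof.
have := @past_invsqrt t i 0 (lexx 0).
by under eq_fun do rewrite addr0.
Qed.

Let gr_bound t i : exists M, forall x, `|gr t i x| <= M.
Proof.
exists (`|grad f w1 0 i| + t%:R * Num.sqrt (L ^+ 2 * (eta ^+ 2 * d%:R))) => x.
exact: (@grad_bounded R d f L f_smooth eta w1 nu0 nu0_gt0
  (g ^~ x) (nu ^~ x) (w ^~ x) (nu_init x) (adagrad_w_init x) (nuS x) (adagrad_wS x)).
Qed.

Let inv_bound t i (c : R) x : 0 <= c ->
  0 <= (Num.sqrt (nu t x 0 i + c))^-1 <= (Num.sqrt (nu0 0 i))^-1.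
Proof.
move=> c0; have n0 : 0 < nu t x 0 i + c by rewrite ltr_wpDr.
rewrite invr_ge0 sqrtr_ge0 lef_pV2 ?posrE ?sqrtr_gt0//.
by rewrite ler_wsqrtr// ler_wpDr.
Qed.

Let inv_bound0 t i x :
  0 <= (Num.sqrt (nu t x 0 i))^-1 <= (Num.sqrt (nu0 0 i))^-1.
Proof. by have := @inv_bound t i 0 x (lexx 0); rewrite addr0. Qed.

Let past_G2 t i : pre t.+1 (G2 t i).
Proof. by apply: measurable_funM => //; apply: measurable_funX. Qed.

Let G2_ge0 t i x : 0 <= G2 t i x.
Proof. by rewrite divr_ge0 ?sqr_ge0// sqrtr_ge0. Qed.

Let G2_int t i : integrableR (G2 t i).
Proof.
have [M hM] := gr_bound t i.
apply: (@integrableR_bdd _ _ _ P (M ^+ 2 * (Num.sqrt (nu0 0 i))^-1)).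
  exact: (sub_measurable (@past_sub t.+1)).
move=> x; rewrite ger0_norm// /G2; have /andP[h0 h1] := inv_bound0 t i x.
by rewrite ler_pM ?sqr_ge0// -real_normK ?num_real// ler_pXn2r ?nnegrE// (le_trans _ (hM x)).
Qed.

Let variance_pullout t i (Z : Omega -> R) (M : R) : pre t.+1 Z ->
  (forall x, 0 <= Z x <= M) ->
  integrableR (fun x => Z x * g t.+1 x 0 i ^+ 2) /\
  \int[P]_x (Z x * g t.+1 x 0 i ^+ 2) <=
  \int[P]_x (Z x * (D0 + D1 * gr t i x ^+ 2)).
Proof.
move=> mZ hZ; have [V [cV VW]] := affine_variance i (ltn0Sn t).
have ig : integrableR (fun x => `|g t.+1 x 0 i| ^+ 2) by case: cV.
have bZ x : `|Z x| <= M by have /andP[? ?] := hZ x; rewrite ger0_norm.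
have eg : (fun x => Z x * g t.+1 x 0 i ^+ 2) = (fun x => Z x * `|g t.+1 x 0 i| ^+ 2).
  by apply: funext => x; rewrite real_normK ?num_real.
have [N hN] := gr_bound t i.
have iW : integrableR (fun x => D0 + D1 * gr t i x ^+ 2).
  apply: integrableR_add; first exact: integrableR_cst.
  apply: integrableR_scale; apply: (@integrableR_bdd _ _ _ P (N ^+ 2)).
    by apply: measurable_funX; exact: (sub_measurable (@past_sub t.+1)).
  by move=> x; rewrite normrX ler_pXn2r ?nnegrE// (le_trans _ (hN x)).
rewrite eg; split.
  exact: integrableR_bddM (sub_measurable (@past_sub t.+1) mZ) bZ ig.
apply: (cond_expectation_pullout_le (@past_sub t.+1) cV iW _ mZ hZ).
by apply: filterS VW => x; rewrite /gr mxE.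
Qed.

Local Notation prog t i x := (progress f eta D0 D1 (g ^~ x) (nu ^~ x) (w ^~ x) t i).

(** Unbiasedness turns the linear term into eta E[G^2 / a]. The affine variance bound, with weight
    G^2 / (Q a), limits the quadratic loss to half of that, and the reserve takes a quarter. *)
Lemma progress_expectation t i :
  integrableR (fun x => prog t i x) /\
  eta / 4 * \int[P]_x G2 t i x <= \int[P]_x prog t i x.
Proof.
have [M hM] := gr_bound t i.
have M0 : 0 <= M by exact: le_trans (hM point).
pose r := (Num.sqrt (nu0 0 i))^-1.
pose Z1 x := gr t i x / Num.sqrt (nu t x 0 i).
pose Q x := D0 + D1 * gr t i x ^+ 2.
pose Z2 x := gr t i x ^+ 2 / Q x / Num.sqrt (nu t x 0 i).
have Q0 x : 0 <= Q x by rewrite addr_ge0// mulr_ge0 ?sqr_ge0// ltW.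
have pQ : pre t.+1 Q.
  apply: measurable_funD; first exact: measurable_cst.
  by apply: measurable_funM; [exact: measurable_cst|exact: measurable_funX].
have pZ1 : pre t.+1 Z1 by exact: measurable_funM.
have pZ2 : pre t.+1 Z2.
  apply: measurable_funM => //; apply: measurable_funM; first exact: measurable_funX.
  exact: measurable_fun_inv_ge0.
have bZ1 x : `|Z1 x| <= M * r.
  rewrite normrM; have /andP[h0 h1] := inv_bound0 t i x.
  by rewrite ler_pM// ger0_norm.
(* Since Q >= D1 G^2, the ratio G^2 / Q is at most 1 / D1; for Q = 0 it is 0 by convention. *)
have bZ2 x : 0 <= Z2 x <= D1^-1 * r.
  have /andP[h0 h1] := inv_bound0 t i x.
  have q0 : 0 <= gr t i x ^+ 2 / Q x by rewrite divr_ge0// sqr_ge0.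
  rewrite mulr_ge0//= ler_pM//.
  have [->|Qn] := eqVneq (Q x) 0; first by rewrite invr0 mulr0 invr_ge0 ltW.
  rewrite ler_pdivrMr ?lt_def ?Qn ?Q0// ler_pdivlMl// /Q lerDr//.
have ig : integrableR (fun x => g t.+1 x 0 i) by case: (unbiased i (ltn0Sn t)).
have i1 : integrableR (fun x => Z1 x * g t.+1 x 0 i).
  exact: integrableR_bddM (sub_measurable (@past_sub t.+1) pZ1) bZ1 ig.
have [i2 e2] := variance_pullout i pZ2 bZ2.
have e1 : \int[P]_x (Z1 x * g t.+1 x 0 i) = \int[P]_x G2 t i x.
  rewrite (cond_expectation_pullout (@past_sub t.+1) (unbiased i (ltn0Sn t)) pZ1 bZ1).
  by apply: eq_Rintegral => x _; rewrite /Z1 /G2 /gr mulrAC -expr2.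
have e3 : \int[P]_x (Z2 x * Q x) <= \int[P]_x G2 t i x.
  apply: le_Rintegral => //.
    have iQ : integrableR Q.
      apply: (@integrableR_bdd _ _ _ P (D0 + D1 * M ^+ 2)).
        exact: (sub_measurable (@past_sub t.+1)).
      move=> x; rewrite ger0_norm// /Q lerD2l ler_wpM2l// ?(ltW D1_gt0)//.
      by rewrite -real_normK ?num_real// ler_pXn2r ?nnegrE.
    apply: (integrableR_bddM (sub_measurable (@past_sub t.+1) pZ2) _ iQ) => x.
    by have /andP[? ?] := bZ2 x; rewrite ger0_norm//; eassumption.
  move=> x _; rewrite /Z2 /G2.
  have [->|Qn] := eqVneq (Q x) 0; first by rewrite mulr0 divr_ge0 ?sqr_ge0 ?sqrtr_ge0.
  by rewrite mulrAC divfK.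
have ep : (fun x => prog t i x) = (fun x => eta * (Z1 x * g t.+1 x 0 i) +
    ((- (eta / 2)) * (Z2 x * g t.+1 x 0 i ^+ 2) + (- (eta / 4)) * G2 t i x)).
  by apply: funext => x; rewrite /progress /Z1 /Z2 /Q /G2 /gr; ring.
have j1 := integrableR_scale eta i1.
have j2 := integrableR_scale (- (eta / 2)) i2.
have j3 := integrableR_scale (- (eta / 4)) (@G2_int t i).
have j23 := integrableR_add j2 j3.
split; first by rewrite ep; exact: integrableR_add.
have -> : \int[P]_x prog t i x = \int[P]_x (eta * (Z1 x * g t.+1 x 0 i) +
    ((- (eta / 2)) * (Z2 x * g t.+1 x 0 i ^+ 2) + (- (eta / 4)) * G2 t i x)).
  by rewrite -[in RHS]/(Rintegral _ _ _) -ep.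
rewrite RintegralD// RintegralD// !RintegralZl// e1.
have := ler_wpM2l (ltW eta_gt0) (le_trans e2 e3).
set u := \int[P]_x G2 t i x; set v := \int[P]_x _; move: eta_gt0; lra.
Qed.

(** In the D0 part the denominator is at least sqrt c; in the D1 part the shift is dropped. Writing
    D0 <= kap sqrt c avoids dividing by c, which is 0 when D0 = 0 in the application. *)
Lemma increment_expectation t i (c kap : R) : 0 <= c -> 0 <= kap ->
  D0 <= kap * Num.sqrt c ->
  integrableR (fun x => (Num.sqrt (nu t x 0 i + c))^-1 * g t.+1 x 0 i ^+ 2) /\
  \int[P]_x ((Num.sqrt (nu t x 0 i + c))^-1 * g t.+1 x 0 i ^+ 2) <=
  kap + D1 * \int[P]_x G2 t i x.
Proof.
move=> c0 k0 hk.
have [i1 e1] := variance_pullout i (@past_invsqrt t i c c0) (fun x => @inv_bound t i c x c0).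
split=> //; apply: le_trans e1 _.
have iG := integrableR_scale D1 (@G2_int t i).
rewrite -RintegralZl// -[X in X + _](Rintegral_prob_cst P) -RintegralD//; last first.
  exact: integrableR_cst.
have [M hM] := gr_bound t i.
apply: le_Rintegral => //.
- have [N hN] : exists N, forall x, `|D0 + D1 * gr t i x ^+ 2| <= N.
    exists (D0 + D1 * M ^+ 2) => x.
    rewrite ger0_norm; last by rewrite addr_ge0// mulr_ge0 ?sqr_ge0// ltW.
    rewrite lerD2l; apply: ler_wpM2l; first exact: ltW.
    by rewrite -real_normK ?num_real// ler_pXn2r ?nnegrE// (le_trans _ (hM x)).
  have iQ : integrableR (fun x => D0 + D1 * gr t i x ^+ 2).
    apply: (@integrableR_bdd _ _ _ P N) => //.
    apply: measurable_funD; first exact: measurable_cst.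
    apply: measurable_funM; first exact: measurable_cst.
    by apply: measurable_funX; exact: (sub_measurable (@past_sub t.+1)).
  have bZ x : `|(Num.sqrt (nu t x 0 i + c))^-1| <= (Num.sqrt (nu0 0 i))^-1.
    by have /andP[? ?] := @inv_bound t i c x c0; rewrite ger0_norm.
  exact: (integrableR_bddM (sub_measurable (@past_sub t.+1) (@past_invsqrt t i c c0)) bZ iQ).
- by apply: integrableR_add => //; exact: integrableR_cst.
move=> x _; rewrite mulrDr; apply: lerD.
  rewrite mulrC ler_pdivrMr ?sqrtr_gt0 ?ltr_wpDr//.
  by apply: le_trans hk _; rewrite ler_wpM2l// ler_wsqrtr// lerDr ltW.
rewrite mulrC -mulrA ler_wpM2l ?(ltW D1_gt0)// ler_wpM2l ?sqr_ge0//.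
by rewrite lef_pV2 ?posrE ?sqrtr_gt0 ?ltr_wpDr// ler_wsqrtr// lerDl.
Qed.

(** Dominated by 1 + nu, which is integrable because the squared gradients are. *)
Lemma sqrt_nu_int T i : integrableR (fun x => Num.sqrt (nu T x 0 i)).
Proof.
have iN : integrableR (fun x => nu T x 0 i).
  elim: T => [|T IH].
    by under eq_fun do rewrite nu_init; exact: integrableR_cst.
  under eq_fun do rewrite nuS; apply: integrableR_add => //.
  have [V [[+ _ _ _] _]] := affine_variance i (ltn0Sn T).
  by under eq_fun do rewrite real_normK ?num_real//.
apply: (le_integrable measurableT _ _ (integrableR_add (integrableR_cst P 1) iN)).
  apply/measurable_EFinP; apply: measurable_fun_sqrt.
  exact: integrableR_measurable iN.
move=> x _ /=; rewrite lee_fin ger0_norm ?sqrtr_ge0// ger0_norm ?addr_ge0 ?(ltW (nu_gt0 _ _ _))//.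
have := sqr_sqrtr (ltW (nu_gt0 x T i)); have := sqrtr_ge0 (nu T x 0 i).
set s := Num.sqrt _ => s0 <-; have := sqr_ge0 (s - 1); nra.
Qed.

Let SX T x := \sum_(i < d) Num.sqrt (nu T x 0 i).
Let SY T x := \sum_(t < T) \sum_(i < d) G2 t i x.

Let SX_int T : integrableR (SX T).
Proof. by apply: integrableR_sum => i; exact: sqrt_nu_int. Qed.

Let SY_int T : integrableR (SY T).
Proof. by apply: integrableR_sum => t; apply: integrableR_sum => i; exact: G2_int. Qed.

Let SY_E T : \int[P]_x SY T x = \sum_(t < T) \sum_(i < d) \int[P]_x G2 t i x.
Proof.
rewrite Rintegral_sum => [|t]; last by apply: integrableR_sum => i; exact: G2_int.
by apply: eq_bigr => t _; rewrite Rintegral_sum// => i; exact: G2_int.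
Qed.

(* The shift [c = D0 * T] makes the [D0] part of the variance contribute
   [sqrt (D0 * T)] instead of a multiple of [D0 * T]. *)
Let SX_bound T : (1 <= T)%N ->
  \int[P]_x SX T x <= \sum_(i < d) Num.sqrt (nu0 0 i) +
    2 * d%:R * Num.sqrt (D0 * T%:R) + D1 * \int[P]_x SY T x.
Proof.
move=> T1; set c := D0 * T%:R; set s := Num.sqrt c.
have c0 : 0 <= c by rewrite mulr_ge0.
have Tp : 0 < T%:R :> R by rewrite ltr0n.
have k0 : 0 <= s / T%:R by rewrite divr_ge0 ?sqrtr_ge0.
(* Taking kap = s / T gives kap s = D0, and T copies of kap add up to s. With the s from
   [sqrt_conditioner_le] this makes 2 s per coordinate. *)
have hk : D0 <= s / T%:R * Num.sqrt c.
  by rewrite -/s mulrAC -expr2 sqr_sqrtr// /c mulfK ?gt_eqF.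
have inc t i := increment_expectation t i c0 k0 hk.
pose W x := \sum_(i < d) ((s + Num.sqrt (nu0 0 i)) +
  \sum_(t < T) (Num.sqrt (nu t x 0 i + c))^-1 * g t.+1 x 0 i ^+ 2).
have iW1 i : integrableR (fun x =>
    \sum_(t < T) (Num.sqrt (nu t x 0 i + c))^-1 * g t.+1 x 0 i ^+ 2).
  by apply: integrableR_sum => t; have [] := inc t i.
have iW2 i : integrableR (fun x => (s + Num.sqrt (nu0 0 i)) +
    \sum_(t < T) (Num.sqrt (nu t x 0 i + c))^-1 * g t.+1 x 0 i ^+ 2).
  by apply: integrableR_add => //; exact: integrableR_cst.
have iW : integrableR W by exact: integrableR_sum.
apply: (@le_trans _ _ (\int[P]_x W x)).
  apply: le_Rintegral => // x _; apply: ler_sum => i _.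
  rewrite -lerBlDl.
  exact: (@sqrt_conditioner_le R d nu0 nu0_gt0 (g ^~ x) (nu ^~ x) T c i (nu_init x) (nuS x) c0).
rewrite Rintegral_sum// SY_E exchange_big/= mulr_sumr.
rewrite (_ : 2 * d%:R * s = \sum_(i < d) 2 * s); last first.
  by rewrite sumr_const card_ord -[RHS]mulr_natr mulrAC.
rewrite -!big_split/=; apply: ler_sum => i _.
rewrite RintegralD//; last exact: integrableR_cst.
rewrite Rintegral_prob_cst Rintegral_sum; last by move=> t; have [] := inc t i.
apply: (@le_trans _ _ (s + Num.sqrt (nu0 0 i) +
    \sum_(t < T) (s / T%:R + D1 * \int[P]_x G2 t i x))).
  by rewrite lerD2l; apply: ler_sum => t _; have [] := inc t i.
rewrite big_split/= sumr_const card_ord -mulr_sumr -[_ *+ T]mulr_natr divfK ?gt_eqF//.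
lra.
Qed.

(** Integrates [progress_bound] over outcomes; its right-hand side is affine in [SX]. *)
Let SY_bound (fmin : R) : (forall v, fmin <= f v) ->
  exists c K : R, 0 <= K /\ forall T lam, (1 <= T)%N -> 1 <= lam ->
    eta / 4 * \int[P]_x SY T x <= c + K * (ln lam + (\int[P]_x SX T x) / lam).
Proof.
move=> f_min.
have [c [K [K0 H]]] := progress_bound f_diff f_smooth f_min w1 eta_gt0 D0_ge0 D1_gt0 nu0_gt0.
exists c, K; split=> // -[//|T] lam _ lam1.
have ip t : integrableR (fun x => \sum_(i < d) prog t i x).
  by apply: integrableR_sum => i; have [] := progress_expectation t i.
apply: (@le_trans _ _ (\int[P]_x (\sum_(t < T.+1) \sum_(i < d) prog t i x))).
  rewrite SY_E Rintegral_sum// mulr_sumr; apply: ler_sum => t _.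
  rewrite Rintegral_sum => [|i]; last by have [] := progress_expectation t i.
  by rewrite mulr_sumr; apply: ler_sum => i _; have [] := progress_expectation t i.
have iB : integrableR (fun x => (c + K * ln lam) + K / lam * SX T.+1 x).
  by apply: integrableR_add; [exact: integrableR_cst|exact: integrableR_scale].
apply: (@le_trans _ _ (\int[P]_x ((c + K * ln lam) + K / lam * SX T.+1 x))).
  apply: le_Rintegral => //; first exact: integrableR_sum.
  move=> x _.
  apply: le_trans (H (g ^~ x) (nu ^~ x) (w ^~ x) (nu_init x) (adagrad_w_init x)
    (nuS x) (adagrad_wS x) T lam lam1) _.
  by rewrite mulrDr addrA mulrAC -mulrA.
rewrite RintegralD//; [|exact: integrableR_cst|exact: integrableR_scale].
by rewrite Rintegral_prob_cst RintegralZl// mulrDr addrA mulrAC -mulrA.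
Qed.

(** Each G^2 is sqrt nu_t times its term in [SY], and sqrt nu_t <= sqrt nu_T <= [SX] because the
    conditioner is nondecreasing. *)
Let min_le_product T x : (1 <= T)%N ->
  T%:R * min_upto (fun t => enorm (grad f (w t x)) ^+ 2) T <= SX T x * SY T x.
Proof.
move=> T1; set m := min_upto _ _.
apply: (@le_trans _ _ (\sum_(t < T) enorm (grad f (w t.+1 x)) ^+ 2)).
  rewrite mulr_natl -[X in _ *+ X]card_ord -sumr_const; apply: ler_sum => t _.
  by apply: (@min_upto_le _ (fun t => enorm (grad f (w t x)) ^+ 2)); rewrite ltn_ord.
rewrite /SY mulr_sumr; apply: ler_sum => t _.
rewrite enorm_sqr mulr_sumr; apply: ler_sum => i _.
have mono s k : nu s x 0 i <= nu (s + k)%N x 0 i.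
  elim: k => [|k IH]; first by rewrite addn0.
  by rewrite addnS nuS; apply: le_trans IH _; rewrite lerDl sqr_ge0.
have tX : Num.sqrt (nu t x 0 i) <= SX T x.
  apply: (@le_trans _ _ (Num.sqrt (nu T x 0 i))).
    by rewrite ler_wsqrtr//; have := mono t (T - t)%N; rewrite subnKC// ltnW.
  rewrite /SX (bigD1 i)//= lerDl; apply: sumr_ge0 => j _; exact: sqrtr_ge0.
apply: le_trans (ler_wpM2r (@G2_ge0 t i x) tX).
by rewrite /G2 mulrC divfK// gt_eqF// sqrtr_gt0.
Qed.

Lemma adagrad_rate (fmin : R) : (forall v, fmin <= f v) ->
  exists C : R, forall (T : nat) (delta : R),
    (1 <= T)%N -> 0 < delta < 1 ->
    ((1 - delta)%:E <=
     P [set x | min_upto (fun t => enorm (grad f (w t x)) ^+ 2) T <=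
         C * ((1 + ln (1 + Num.sqrt (D0 * T%:R))) / (T%:R * delta ^+ 2)) +
         C * (Num.sqrt D0 * (1 + ln (1 + Num.sqrt (D0 * T%:R))) /
              (Num.sqrt T%:R * delta ^+ 2))]%R)%E.
Proof.
move=> f_min; have [c [K [K0 HY]]] := SY_bound f_min.
have al0 : 0 < eta / 4 by rewrite divr_gt0.
have k0 : 0 <= 2 * d%:R :> R by rewrite mulr_ge0.
have [CS [CA [CS0 CA0 HC]]] :=
  self_bounding_rates c (\sum_(i < d) Num.sqrt (nu0 0 i)) al0 K0 k0 D1_gt0.
exists (CS * CA) => T delta T1 /andP[d0 d1].
have Tp : 0 < T%:R :> R by rewrite ltr0n.
set s := Num.sqrt (D0 * T%:R).
have s0 : 0 <= s by exact: sqrtr_ge0.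
have X0 x : 0 <= SX T x by apply: sumr_ge0 => i _; exact: sqrtr_ge0.
have Y0 x : 0 <= SY T x by apply: sumr_ge0 => t _; apply: sumr_ge0.
have [EX EY] := HC s _ _ s0 (Rintegral_ge0 P (fun x _ => X0 x))
  (Rintegral_ge0 P (fun x _ => Y0 x)) (SX_bound T1) (fun lam => @HY T lam T1).
have s1 : 0 < 1 + s by rewrite ltr_wpDr.
have l0 : 0 <= ln (1 + s) by rewrite ln_ge0// lerDl.
have a0 : 0 < CS * (1 + s) by rewrite mulr_gt0.
have b0 : 0 < CA * (1 + ln (1 + s)) by rewrite mulr_gt0// ltr_wpDr.
have := product_markov (@SX_int T) (@SY_int T) X0 Y0 a0 b0 EX EY d0.
move=> /le_trans; apply; apply: le_measure; rewrite ?inE.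
- rewrite -[X in measurable X]setTI; apply: measurable_fun_le => //.
  exact: measurable_funM (integrableR_measurable (@SX_int T)) (integrableR_measurable (@SY_int T)).
- rewrite -[X in measurable X]setTI; apply: measurable_fun_le => //.
  apply: (@measurable_min_upto R disp Omega (fun x t => enorm (grad f (w t x)) ^+ 2)).
  move=> [//|t] _; under eq_fun do rewrite enorm_sqr.
  apply: measurable_sum => i; apply: measurable_funX.
  exact: (sub_measurable (@past_sub t.+1) (@past_gr t i)).
move=> x /= hx; rewrite -(ler_pM2l Tp).
apply: le_trans (min_le_product x T1) _; apply: le_trans hx _.
(* As sqrt D0 / sqrt T = s / T, the two terms of the rate add up to C (1 + s) (1 + ln (1 + s)) / (T
   delta^2), the product bound divided by T. *)
have -> : Num.sqrt D0 * (1 + ln (1 + s)) / (Num.sqrt T%:R * delta ^+ 2) =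
    s * (1 + ln (1 + s)) / (T%:R * delta ^+ 2).
  move: (ln _) => l; rewrite /s sqrtrM//.
  have rT : 0 < Num.sqrt T%:R :> R by rewrite sqrtr_gt0.
  move: (sqr_sqrtr (ltW Tp)) rT; move: (Num.sqrt T%:R) => r <- r0.
  by field; rewrite !gt_eqF.
rewrite le_eqVlt; apply/orP; left; apply/eqP.
move: (ln _) => l; field; by rewrite !gt_eqF.
Qed.

End adagrad_expectation.

Theorem theorem6 (R : realType) (d : nat) (f : 'rV[R]_d -> R)
  (f_diff : forall w, differentiable f w)
  (f_bounded_below : has_lbound (range f))
  (L : R)
  (f_smooth : forall w w', enorm (grad f w - grad f w') <= L * enorm (w - w'))
  (eta : R) (eta_gt0 : 0 < eta)
  (w1 nu0 : 'rV[R]_d) (nu0_gt0 : forall l, 0 < nu0 0 l)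
  (disp : measure_display) (Omega : measurableType disp)
  (P : probability Omega R)
  (g nu w : nat -> Omega -> 'rV[R]_d)
  (g_measurable : forall t (i : 'I_d), (1 <= t)%N ->
     measurable_fun [set: Omega] (fun x => g t x 0 i))
  (gen : adagrad eta w1 nu0 g nu w)
  (unbiased : forall t (i : 'I_d), (1 <= t)%N ->
     is_cond_expectation P (past g t)
       (fun x => g t x 0 i) (fun x => grad f (w t x) 0 i))
  (D0 D1 : R) (D0_ge0 : 0 <= D0) (D1_gt0 : 0 < D1)
  (affine_variance : forall t (i : 'I_d), (1 <= t)%N ->
     exists V : Omega -> R,
       is_cond_expectation P (past g t) (fun x => `|g t x 0 i| ^+ 2) V /\
       {ae P, forall x, V x <= D0 + D1 * (partial f i (w t x)) ^+ 2}) :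
  exists C : R, forall (T : nat) (delta : R),
    (1 <= T)%N -> 0 < delta < 1 ->
    ((1 - delta)%:E <=
     P [set x | min_upto (fun t => enorm (grad f (w t x)) ^+ 2) T <=
         C * ((1 + ln (1 + Num.sqrt (D0 * T%:R))) / (T%:R * delta ^+ 2)) +
         C * (Num.sqrt D0 * (1 + ln (1 + Num.sqrt (D0 * T%:R))) /
              (Num.sqrt T%:R * delta ^+ 2))]%R)%E.
Proof.
have [fmin hmin] := f_bounded_below.
apply: (adagrad_rate f_diff f_smooth eta_gt0 nu0_gt0 g_measurable gen unbiased
  D0_ge0 D1_gt0 affine_variance (fmin := fmin)).
by move=> v; apply: hmin; exists v.
Qed.
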